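(* Let $G$ be a finitely generated group with undecidable domino problem, and let $\mathscr{P}$ be a nontrivial dynamical property of $G$-SFTs (some $G$-SFT satisfies $\mathscr{P}$ and some $G$-SFT does not). (a) If $\mathscr{P}$ is preserved to topological factors and is satisfied by the empty subshift, then $\mathscr{P}$ is undecidable. (b) If $\mathscr{P}$ is preserved to topological extensions and is not satisfied by the empty subshift, then $\mathscr{P}$ is undecidable.
   Context: Let $G$ be a finitely generated group and fix a finite symmetric generating set $S$ of $G$. For a word $w\in S^{*}$, $\underline{w}\in G$ denotes the corresponding group element. Subshifts. For a finite alphabet $A$, $A^G=\{x\colon G\to A\}$ carries the prodiscrete topology and the shift action $(gx)(h)=x(g^{-1}h)$. A subshift is a closed shift-invariant subset of $A^G$; the empty set is allowed. A morphism of subshifts is a continuous map commuting with the shift action; it is a conjugacy if bijective. If there is a surjective morphism $X\to Y$, then $Y$ is a (topological) factor of $X$ and $X$ is a (topological) extension of $Y$. SFT presentations. A pattern presentation is a function $p\colon W\to A$ with $W\subset S^{*}$ finite and $A\subset\mathbb{N}$ a finite alphabet. It appears in $x\in A^G$ at $g\in G$ when $x(g\underline{w})=p(w)$ for every $w\in W$. An SFT presentation is a pair $(A,\mathcal{F})$ with $A\subset\mathbb{N}$ a finite alphabet and $\mathcal{F}$ a finite set of pattern presentations $p\colon W\to A$. It determines the subshift $X_{(A,\mathcal{F})}\subset A^G$ of all configurations in which no element of $\mathcal{F}$ appears (at any $g\in G$). Subshifts of this form are called $G$-SFTs; the empty subshift is a $G$-SFT. The domino problem of $G$ is the set $\operatorname{DP}(G)$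 of all SFT presentations $(A,\mathcal{F})$ such that $X_{(A,\mathcal{F})}=\emptyset$; $G$ has undecidable domino problem if this set is not decidable. A dynamical property of $G$-SFTs is a property of $G$-SFTs (with a yes/no value also assigned to the empty subshift) that is invariant under conjugacy. It is preserved to factors (resp. extensions) if whenever a $G$-SFT satisfies it, so does every $G$-SFT that is a factor (resp. an extension) of it. It is undecidable if the set $\{(A,\mathcal{F})\mid X_{(A,\mathcal{F})}\text{ satisfies }\mathscr{P}\}$ of presentations is not decidable. *)

(* Defs.v *)
From mathcomp Require Import all_boot all_classical topology.
From Stdlib Require Import Cantor.

Set Implicit Arguments.
Unset Strict Implicit.
Unset Printing Implicit Defensive.

Local Open Scope group_scope.
Local Open Scope classical_set_scope.

(* The total recursive functions on nat: Kleene's closure under composition,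
   primitive recursion and minimization of regular functions.  Arguments are
   packed into one natural number by Cantor's pairing bijection
   Cantor.to_nat : nat * nat -> nat, whose inverse is Cantor.of_nat. *)
Inductive recursive : (nat -> nat) -> Prop :=
| rec_zero : recursive (fun _ => 0)
| rec_succ : recursive (fun n => n.+1)
| rec_fst : recursive (fun n => (Cantor.of_nat n).1)
| rec_snd : recursive (fun n => (Cantor.of_nat n).2)
| rec_pair f g : recursive f -> recursive g ->
    recursive (fun n => Cantor.to_nat (f n, g n))
| rec_comp f g : recursive f -> recursive g -> recursive (fun n => f (g n))
| rec_prec f g h : recursive f -> recursive g ->
    (forall a, h (Cantor.to_nat (a, 0)) = f a) ->
    (forall a k, h (Cantor.to_nat (a, k.+1)) =
       g (Cantor.to_nat (a, Cantor.to_nat (k, h (Cantor.to_nat (a, k)))))) ->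
    recursive h
| rec_mu f g : recursive f ->
    (forall a, f (Cantor.to_nat (a, g a)) = 0 /\
       forall k, k < g a -> f (Cantor.to_nat (a, k)) <> 0) ->
    recursive g.

(* The characteristic function of D is computable on the codes of the
   elements of T. *)
Definition decidable_set (T : Type) (code : T -> nat) (D : set T) : Prop :=
  exists2 f, recursive f & forall x, f (code x) = `[< D x >].

Section Presentations.
Variable n : nat.

(* S = {s_0, ..., s_(n-1)} is given by an enumeration; the letter s_i of a
   word over S is represented by its index i. *)
Definition word := seq 'I_n.

(* The graph of a function p : W -> A, as a list of pairs (w, p w). *)
Definition pattern := seq (word * nat).

Definition is_pattern (A : seq nat) (p : pattern) : bool :=
  uniq [seq wa.1 | wa <- p] && all (fun wa => wa.2 \in A) p.

(* Finite sets are given by lists of their elements. *)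
Record presentation := Presentation {
  alphabet : seq nat;
  forbidden : seq pattern;
  forbiddenP : all (is_pattern alphabet) forbidden }.

Definition code_seq (T : Type) (code : T -> nat) (s : seq T) : nat :=
  foldr (fun x k => (Cantor.to_nat (code x, k)).+1) 0 s.

Definition code_pattern (p : pattern) : nat :=
  code_seq (fun wa : word * nat =>
    Cantor.to_nat (code_seq (fun i : 'I_n => nat_of_ord i) wa.1, wa.2)) p.

Definition code_presentation (p : presentation) : nat :=
  Cantor.to_nat (code_seq id (alphabet p), code_seq code_pattern (forbidden p)).

End Presentations.

Definition symmetric_generating (G : groupType) (n : nat) (S : n.-tuple G) :
    Prop :=
  [/\ uniq S,
      forall s, s \in S -> s^-1 \in S
    & forall g : G, exists w : word n, g = \prod_(i <- w) tnth S i].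

(* nat is discrete and this is the product topology.  For finite A in nat, A^G
   is the subspace of the configurations with values in A, and its
   prodiscrete topology is the induced one; so every subshift over a finite
   alphabet contained in nat is a subset of this space. *)
Definition config (G : groupType) := prod_topology (fun _ : G => nat).

Definition shift (G : groupType) (g : G) (x : config G) : config G :=
  fun h => x (g^-1 * h).

Section Subshifts.
Variable G : groupType.
Implicit Types X Y : set (config G).

Definition is_morphism X Y (phi : config G -> config G) : Prop :=
  [/\ set_fun X Y phi,
      {within X, continuous phi}
    & forall g x, X x -> phi (shift g x) = shift g (phi x)].

Definition conjugate X Y : Prop :=
  exists2 phi, is_morphism X Y phi & set_bij X Y phi.

Definition is_factor Y X : Prop :=
  exists2 phi, is_morphism X Y phi & set_surj X Y phi.

Definition is_extension X Y : Prop := is_factor Y X.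

End Subshifts.

Section SFT.
Variables (G : groupType) (n : nat) (S : n.-tuple G).

Definition appears (p : pattern n) (x : config G) (g : G) : Prop :=
  forall w a, (w, a) \in p -> x (g * \prod_(i <- w) tnth S i) = a.

Definition subshift_of (p : presentation n) : set (config G) :=
  [set x | (forall g, x g \in alphabet p) /\
           forall q g, q \in forbidden p -> ~ appears q x g].

Definition is_SFT (X : set (config G)) : Prop :=
  exists p : presentation n, X = subshift_of p.

Definition domino_problem : set (presentation n) :=
  [set p | subshift_of p = set0].

(* In what follows a property of G-SFTs is a predicate P on sets of
   configurations, of which only the values on G-SFTs matter. *)
Definition property_undecidable (P : set (set (config G))) : Prop :=
  ~ decidable_set (@code_presentation n) [set p | P (subshift_of p)].

Definition dynamical_property (P : set (set (config G))) : Prop :=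
  forall X Y, is_SFT X -> is_SFT Y -> conjugate X Y -> (P X <-> P Y).

Definition nontrivial_property (P : set (set (config G))) : Prop :=
  (exists2 X, is_SFT X & P X) /\ (exists2 X, is_SFT X & ~ P X).

Definition preserved_to_factors (P : set (set (config G))) : Prop :=
  forall X Y, is_SFT X -> is_SFT Y -> is_factor Y X -> P X -> P Y.

Definition preserved_to_extensions (P : set (set (config G))) : Prop :=
  forall X Y, is_SFT X -> is_SFT Y -> is_extension Y X -> P X -> P Y.

End SFT.

(* Main.v *)
Require Import Defs.
From mathcomp Require Import all_boot all_classical topology.
From Stdlib Require Import Cantor.

(** The domino problem reduces to the property through direct products.  Fix a
    presentation of a [G]-SFT [Y].  If [X] is an SFT, then so is [X * Y], seen
    as a subshift over the alphabet of coded pairs of letters.  It is empty when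
    [X] is, and otherwise the second projection maps it onto [Y]: once a point
    [x] of [X] is chosen, every [y] in [Y] is the image of [(x, y)].

    - If [P] passes to factors and holds for the empty subshift, let [Y] violate
      [P].  Then [X * Y] has [P] if and only if [X] is empty.
    - If [P] passes to extensions and fails for the empty subshift, let [Y]
      satisfy [P].  Then [X * Y] has [P] if and only if [X] is nonempty.

    So an algorithm for [P] yields one for the domino problem, provided that a
    presentation of [X * Y] is computable from one of [X].  To forbid a pattern
    [p] of [X] in the first coordinate, one has to forbid each of the finitely
    many patterns of pairs that project to [p] ([extend], [extend_appears]), and
    symmetrically for [Y].  These lists are built by folding over lists, so what
    is to be shown about recursive functions is closure under folds
    ([computable_foldr]); the rest of the construction follows by composition
    ([computable_product]). *)

Set Implicit Arguments.
Unset Strict Implicit.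
Unset Printing Implicit Defensive.

(** * Computable functions between coded types *)

(** Instances are stated so that they unfold to the codes of words, patterns and
    presentations used in the definition of a decidable set. *)
Class coding (T : Type) := encode : T -> nat.

#[export] Instance coding_nat : coding nat := id.
#[export] Instance coding_ord n : coding 'I_n := @nat_of_ord n.
#[export] Instance coding_prod T U (cT : coding T) (cU : coding U) :
  coding (T * U) := fun x => Cantor.to_nat (encode x.1, encode x.2).
#[export] Instance coding_seq T (cT : coding T) : coding (seq T) :=
  code_seq cT.

Definition computable T U {cT : coding T} {cU : coding U} (f : T -> U) : Prop :=
  exists2 F, recursive F & forall x, F (encode x) = encode (f x).

Section Computable.
Context {E T U V : Type} {cE : coding E} {cT : coding T} {cU : coding U}
  {cV : coding V}.

Lemma recursive_id : recursive id.
Proof.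
have -> : @id nat =
    fun m => Cantor.to_nat ((Cantor.of_nat m).1, (Cantor.of_nat m).2).
  by apply/funext => m; rewrite -surjective_pairing Cantor.cancel_to_of.
exact: rec_pair rec_fst rec_snd.
Qed.

Lemma recursive_const k : recursive (fun=> k).
Proof.
elim: k => [|k IHk]; first exact: rec_zero.
exact: rec_comp rec_succ IHk.
Qed.

(** On codes, this function is the identity.  It provides a recursive bound on
    the size of a list ([size_le_encode]). *)
Lemma computable_encode : computable (fun x : T => encode x).
Proof. by exists id => //; apply: recursive_id. Qed.

Lemma computable_id : computable (fun x : T => x).
Proof. by exists id => //; apply: recursive_id. Qed.

Lemma computable_const (y : U) : computable (fun _ : T => y).
Proof. by exists (fun=> encode y) => //; apply: recursive_const. Qed.

Lemma computable_comp (g : U -> V) (f : T -> U) :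
  computable g -> computable f -> computable (fun x => g (f x)).
Proof.
move=> [g' rg' g'E] [f' rf' f'E]; exists (fun m => g' (f' m)).
  exact: rec_comp.
by move=> x; rewrite f'E g'E.
Qed.

Lemma computable_pair (f : T -> U) (g : T -> V) :
  computable f -> computable g -> computable (fun x => (f x, g x)).
Proof.
move=> [f' rf' f'E] [g' rg' g'E].
exists (fun m => Cantor.to_nat (f' m, g' m)); first exact: rec_pair.
by move=> x; rewrite f'E g'E.
Qed.

Lemma computable_fst (f : T -> U * V) :
  computable f -> computable (fun x => (f x).1).
Proof.
move=> [f' rf' f'E]; exists (fun m => (Cantor.of_nat (f' m)).1).
  exact: rec_comp rec_fst rf'.
by move=> x; rewrite f'E Cantor.cancel_of_to.
Qed.

Lemma computable_snd (f : T -> U * V) :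
  computable f -> computable (fun x => (f x).2).
Proof.
move=> [f' rf' f'E]; exists (fun m => (Cantor.of_nat (f' m)).2).
  exact: rec_comp rec_snd rf'.
by move=> x; rewrite f'E Cantor.cancel_of_to.
Qed.

(** A pair of numbers and its code are the same number. *)
Lemma computable_to_nat : computable Cantor.to_nat.
Proof. by exists id; [apply: recursive_id | case]. Qed.

Lemma computable_cons (f : T -> U) (s : T -> seq U) :
  computable f -> computable s -> computable (fun x => f x :: s x).
Proof.
move=> [f' rf' f'E] [s' rs' s'E].
exists (fun m => (Cantor.to_nat (f' m, s' m)).+1).
  exact: rec_comp rec_succ (rec_pair rf' rs').
by move=> x; rewrite f'E s'E.
Qed.

(** A recursion whose step ignores the previous value is a case distinction; it
    tells the empty list, of code 0, from the lists of successor code. *)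
Lemma recursive_case f g : recursive f -> recursive g ->
  recursive (fun m => if (Cantor.of_nat m).2 is k.+1
    then g (Cantor.to_nat ((Cantor.of_nat m).1, k))
    else f (Cantor.of_nat m).1).
Proof.
move=> rf rg.
pose drop m := Cantor.to_nat
  ((Cantor.of_nat m).1, (Cantor.of_nat (Cantor.of_nat m).2).1).
apply: (@rec_prec f (fun m => g (drop m))) => //.
- apply: rec_comp rg _; apply: rec_pair rec_fst _.
  exact: rec_comp rec_fst rec_snd.
- by move=> a; rewrite Cantor.cancel_of_to.
- by move=> a k; rewrite /drop !Cantor.cancel_of_to.
Qed.

Lemma computable_case_seq (z : E -> U) (f : E * (T * seq T) -> U) :
  computable z -> computable f ->
  computable (fun el : E * seq T =>
    if el.2 is x :: s then f (el.1, (x, s)) else z el.1).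
Proof.
move=> [z' rz' z'E] [f' rf' f'E].
eexists; first exact: (recursive_case rz' rf').
by move=> [e [|x s]]; rewrite Cantor.cancel_of_to /= -?z'E -?f'E.
Qed.

Lemma computable_iter (f : T -> T) :
  computable f -> computable (fun xk : T * nat => iter xk.2 f xk.1).
Proof.
move=> [f' rf' f'E].
exists (fun m => iter (Cantor.of_nat m).2 f' (Cantor.of_nat m).1).
  apply: (@rec_prec id (fun m => f' (Cantor.of_nat (Cantor.of_nat m).2).2)).
  - exact: recursive_id.
  - by apply: rec_comp rf' _; apply: rec_comp rec_snd rec_snd.
  - by move=> a; rewrite Cantor.cancel_of_to.
  - by move=> a k; rewrite !Cantor.cancel_of_to.
move=> [x k]; rewrite Cantor.cancel_of_to /= /encode /coding_nat /=.
by elim: k => //= k ->; rewrite f'E.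
Qed.

End Computable.

#[local] Hint Resolve computable_id computable_const computable_pair
  computable_fst computable_snd computable_cons : core.

(** Functions that only rearrange the components of their argument. *)
Ltac rearrange := rewrite /=; eauto 10.

Lemma size_le_encode T (cT : coding T) (s : seq T) : size s <= encode s.
Proof.
elim: s => //= x s IHs; rewrite ltnS; apply: leq_trans IHs _.
have le_xs : encode s + cT x <= Cantor.to_nat (cT x, encode s).
  by apply/ssrnat.leP; apply: Cantor.to_nat_non_decreasing.
exact: leq_trans (leq_addr _ _) le_xs.
Qed.

Section Folds.
Context {E T U : Type} {cE : coding E} {cT : coding T} {cU : coding U}.

(** A left fold iterates a step that consumes the head of the list and updates
    an accumulator.  The step is idle on the empty list, so that any number of
    iterations from the size of the list on gives the result: its code will
    do.  The data [e] on which everything may depend travel unchanged in the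
    state, which lets folds be nested. *)
Lemma computable_foldl (f : E -> U -> T -> U) (z : E -> U) (l : E -> seq T) :
  computable (fun t : E * (U * T) => f t.1 t.2.1 t.2.2) ->
  computable z -> computable l ->
  computable (fun e => foldl (f e) (z e) (l e)).
Proof.
move=> cf cz cl.
pose step (t : E * U * seq T) :=
  if t.2 is x :: s then (t.1.1, f t.1.1 t.1.2 x, s) else (t.1, [::]).
have cstep : computable step.
  apply: (@computable_case_seq (E * U) _ _ _ _ _ (fun t => (t, [::]))
    (fun t => (t.1.1, f t.1.1 t.1.2 t.2.1, t.2.2))); first by rearrange.
  do 2![apply: computable_pair; rearrange].
  apply: (computable_comp cf
    (f := fun t : E * U * (T * seq T) => (t.1.1, (t.1.2, t.2.1)))).
  by rearrange.
have iter_step e s k u :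
    size s <= k -> iter k step (e, u, s) = (e, foldl (f e) u s, [::]).
  elim: k s u => [|k IHk] [|x s] u //= lt_sk.
    by rewrite IHk.
  by rewrite -iterS iterSr IHk.
have -> : (fun e => foldl (f e) (z e) (l e)) =
    (fun e => (iter (encode (l e)) step (e, z e, l e)).1.2).
  by apply/funext => e; rewrite iter_step // size_le_encode.
apply: computable_snd; apply: computable_fst.
apply: (computable_comp (computable_iter cstep)
  (f := fun e => ((e, z e, l e), encode (l e)))).
by apply: computable_pair (computable_comp computable_encode cl); rearrange.
Qed.

End Folds.

Section RightFolds.
Context {E T U : Type} {cE : coding E} {cT : coding T} {cU : coding U}.

Lemma computable_rev (l : E -> seq T) :
  computable l -> computable (fun e => rev (l e)).
Proof.
move=> cl.
have -> : (fun e => rev (l e)) =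
    (fun e => foldl (fun s x => x :: s) [::] (l e)).
  apply/funext => e; rewrite -[in RHS](revK (l e)) foldl_rev.
  by elim: (rev _) => //= x s {1}->.
by apply: (computable_foldl (f := fun _ s x => x :: s) (z := fun=> [::]));
  rearrange.
Qed.

Lemma computable_foldr (f : E -> T -> U -> U) (z : E -> U) (l : E -> seq T) :
  computable (fun t : E * (T * U) => f t.1 t.2.1 t.2.2) ->
  computable z -> computable l ->
  computable (fun e => foldr (f e) (z e) (l e)).
Proof.
move=> cf cz cl.
have -> : (fun e => foldr (f e) (z e) (l e)) =
    (fun e => foldl (fun u x => f e x u) (z e) (rev (l e))).
  by apply/funext => e; rewrite foldl_rev.
apply: (computable_foldl (f := fun e u x => f e x u)) cz (computable_rev cl).
apply: (computable_comp cf
  (f := fun t : E * (U * T) => (t.1, (t.2.2, t.2.1)))).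
by rearrange.
Qed.

End RightFolds.

Section ListOperations.
Context {E T U : Type} {cE : coding E} {cT : coding T} {cU : coding U}.

Lemma computable_map (f : E -> T -> U) (l : E -> seq T) :
  computable (fun t : E * T => f t.1 t.2) -> computable l ->
  computable (fun e => map (f e) (l e)).
Proof.
move=> cf cl.
apply: (computable_foldr (f := fun e x s => f e x :: s) (z := fun=> [::])) =>
  //.
apply: computable_cons; last by rearrange.
by apply: (computable_comp cf (f := fun t : E * (T * seq U) => (t.1, t.2.1)));
  rearrange.
Qed.

Lemma computable_cat (s t : E -> seq T) :
  computable s -> computable t -> computable (fun e => s e ++ t e).
Proof.
move=> cs ct.
have -> : (fun e => s e ++ t e) = (fun e => foldr cons (t e) (s e)).
  by apply/funext => e; elim: (s e) => //= x u ->.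
by apply: (computable_foldr (f := fun=> cons)) ct cs; rearrange.
Qed.

End ListOperations.

Lemma computable_flatten {E T : Type} {cE : coding E} {cT : coding T}
    (l : E -> seq (seq T)) :
  computable l -> computable (fun e => flatten (l e)).
Proof.
move=> cl.
apply: (computable_foldr (f := fun=> cat) (z := fun=> [::])) => //.
by apply: computable_cat; rearrange.
Qed.

Lemma computable_allpairs {E T U V : Type} {cE : coding E} {cT : coding T}
    {cU : coding U} {cV : coding V} (f : E -> T -> U -> V)
    (s : E -> seq T) (t : E -> seq U) :
  computable (fun x : E * (T * U) => f x.1 x.2.1 x.2.2) ->
  computable s -> computable t ->
  computable (fun e => [seq f e x y | x <- s e, y <- t e]).
Proof.
move=> cf cs ct; apply: computable_flatten.
apply: (computable_map (f := fun e x => [seq f e x y | y <- t e])) => //.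
apply: (computable_map (f := fun (ex : E * T) y => f ex.1 ex.2 y)).
  apply: (computable_comp cf
    (f := fun x : E * T * U => (x.1.1, (x.1.2, x.2)))).
  by rearrange.
exact: (computable_comp ct (computable_fst computable_id)).
Qed.

(** * Products of subshifts of finite type *)

Section Extend.
Variable n : nat.

(** Forbidding all these patterns in a configuration of pairs amounts to
    forbidding [p] in one coordinate, when the other one takes its values in
    [C].  The pairing [h] tells which coordinate is which. *)
Definition extend (h : nat * nat -> nat) (C : seq nat) (p : pattern n) :
    seq (pattern n) :=
  foldr (fun wa ps => [seq (wa.1, h (wa.2, c)) :: q | c <- C, q <- ps])
    [:: [::]] p.

Lemma computable_extend E (cE : coding E) (h : nat * nat -> nat)
    (C : E -> seq nat) (p : E -> pattern n) :
  computable h -> computable C -> computable p ->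
  computable (fun e => extend h (C e) (p e)).
Proof.
move=> ch cC cp.
apply: (computable_foldr (z := fun=> [:: [::]]) (f := fun e wa ps =>
  [seq (wa.1, h (wa.2, c)) :: q | c <- C e, q <- ps])) => //.
apply: (computable_allpairs
  (f := fun (t : E * (word n * nat * seq (pattern n))) c q =>
    (t.2.1.1, h (t.2.1.2, c)) :: q)); last by rearrange.
  apply: computable_cons; last by rearrange.
  apply: computable_pair; first by rearrange.
  apply: (computable_comp ch (f :=
    fun x : E * (word n * nat * seq (pattern n)) * (nat * pattern n) =>
      (x.1.2.1.2, x.2.1))).
  by rearrange.
exact: (computable_comp cC (computable_fst computable_id)).
Qed.

Lemma extend_is_pattern h A B C p : is_pattern A p ->
  (forall a c, a \in A -> c \in C -> h (a, c) \in B) ->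
  all (is_pattern B) (extend h C p).
Proof.
move=> pA hB; apply/allP => q qp.
suff [words letters] : [seq wa.1 | wa <- q] = [seq wa.1 | wa <- p] /\
    all (fun wa => wa.2 \in B) q.
  by rewrite /is_pattern words letters andbT; case/andP: pA.
move: pA => /andP[_]; elim: p q qp => [|[w a] p IHp] q /=.
  by rewrite inE => /eqP->.
move=> /allpairsP[[c r] /= [cC rp ->]] /andP[aA /(IHp _ rp) [words rB]] /=.
by rewrite words hB.
Qed.

Variables (G : groupType) (S : n.-tuple G).

(** Among the extensions of [p], the one that can appear at [g] in the
    combination of [x] and [y] is the one that reads the added letters off
    [y]. *)
Lemma extend_appears h C p (x y : config G) g :
  injective h -> (forall k, y k \in C) ->
  (exists2 q, q \in extend h C p & appears S q (fun k => h (x k, y k)) g) <->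
  appears S p x g.
Proof.
move=> h_inj yC; split.
- case=> q; elim: p q => [|[w a] p IHp] q /=; first by move=> _ _ w a.
  move=> /allpairsP[[c r] /= [cC rp ->]] qx w' a'; rewrite inE => /orP[|wp].
    move=> /eqP[-> ->]; have := qx w (h (a, c)).
    by rewrite inE eqxx => /(_ isT)/h_inj[].
  apply: (IHp r) wp => // v b vr; apply: qx.
  by rewrite inE vr orbT.
- elim: p => [|[w a] p IHp] px; first by exists [::].
  case: IHp => [v b vp|r rp rx]; first by apply: px; rewrite inE vp orbT.
  pose k := (g * \prod_(i <- w) tnth S i)%g.
  exists ((w, h (a, y k)) :: r).
    by apply/allpairsP; exists (y k, r); split=> //=.
  move=> v b; rewrite inE => /orP[/eqP[-> ->]|]; last exact: rx.
  by rewrite (px w a) // inE eqxx.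
Qed.

End Extend.

Section Product.
Variable n : nat.

(** The letters of the second factor come second in the coded pairs, whichever
    factor the extended pattern comes from. *)
Definition swapped_pair (ab : nat * nat) : nat := Cantor.to_nat (ab.2, ab.1).

Definition product_alphabet (A B : seq nat) : seq nat :=
  [seq Cantor.to_nat (a, b) | a <- A, b <- B].

Definition product_forbidden (p q : presentation n) : seq (pattern n) :=
  flatten [seq extend Cantor.to_nat (alphabet q) r | r <- forbidden p] ++
  flatten [seq extend swapped_pair (alphabet p) r | r <- forbidden q].

Lemma product_forbiddenP p q :
  all (is_pattern (product_alphabet (alphabet p) (alphabet q)))
    (product_forbidden p q).
Proof.
rewrite all_cat; apply/andP; split; apply/allP => r /flatten_mapP[r0 r0F];
  apply/allP/(extend_is_pattern (allP (forbiddenP _) _ r0F)) => a b aA bA;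
  apply/allpairsP; [by exists (a, b) | by exists (b, a)].
Qed.

Definition product (p q : presentation n) : presentation n :=
  Presentation (product_forbiddenP p q).

Lemma computable_product (q : presentation n) :
  exists2 F, recursive F & forall p : presentation n,
    F (code_presentation p) = code_presentation (product p q).
Proof.
have cto := computable_to_nat.
have [F rF FE] : computable (fun t : seq nat * seq (pattern n) =>
    (product_alphabet t.1 (alphabet q),
     flatten [seq extend Cantor.to_nat (alphabet q) r | r <- t.2] ++
     flatten [seq extend swapped_pair t.1 r | r <- forbidden q])).
  apply: computable_pair.
    apply: (computable_allpairs (f := fun _ a b => Cantor.to_nat (a, b)));
      rearrange.
    by apply: (computable_comp cto
      (f := fun t : seq nat * seq (pattern n) * (nat * nat) => (t.2.1, t.2.2)));
      rearrange.
  apply: computable_cat; apply: computable_flatten.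
    apply: (computable_map (f := fun=> extend Cantor.to_nat (alphabet q)));
      last by rearrange.
    by apply: computable_extend; rearrange.
  apply: (computable_map
    (f := fun t : seq nat * seq (pattern n) => extend swapped_pair t.1));
    last by rearrange.
  apply: computable_extend; [|by rearrange|by rearrange].
  by apply: (computable_comp cto (f := fun ab : nat * nat => (ab.2, ab.1)));
    rearrange.
exists F => // p; exact: (FE (alphabet p, forbidden p)).
Qed.

Variables (G : groupType) (S : n.-tuple G).
Implicit Types (p q : presentation n) (z : config G).

Definition first_coordinate z : config G := fun g => (Cantor.of_nat (z g)).1.
Definition second_coordinate z : config G := fun g => (Cantor.of_nat (z g)).2.
Definition combine (x y : config G) : config G :=
  fun g => Cantor.to_nat (x g, y g).

Lemma combine_coordinates z :
  combine (first_coordinate z) (second_coordinate z) = z.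
Proof.
by apply/funext => g; rewrite /combine -surjective_pairing Cantor.cancel_to_of.
Qed.

Lemma second_combine x y : second_coordinate (combine x y) = y.
Proof.
by apply/funext => g; rewrite /second_coordinate Cantor.cancel_of_to.
Qed.

Lemma subshift_of_product p q x y :
  subshift_of S (product p q) (combine x y) <->
  subshift_of S p x /\ subshift_of S q y.
Proof.
have to_inj : injective Cantor.to_nat := can_inj Cantor.cancel_of_to.
have swap_inj : injective swapped_pair by move=> [a b] [c d] /to_inj[-> ->].
have alphabetE g :
    (combine x y g \in product_alphabet (alphabet p) (alphabet q)) =
    (x g \in alphabet p) && (y g \in alphabet q).
  apply/allpairsP/andP => [[[a b] /= [aA bB xyE]]|[xA yB]].
    by case: (to_inj (_, _) (_, _) xyE) => -> ->.
  by exists (x g, y g).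
split.
- move=> [xyAB xyF].
  have xA g : x g \in alphabet p.
    by have := xyAB g; rewrite alphabetE => /andP[].
  have yB g : y g \in alphabet q.
    by have := xyAB g; rewrite alphabetE => /andP[].
  split; split=> // r g rF.
    move=> /(extend_appears S r x g to_inj yB)[s sr]; apply: xyF.
    by rewrite mem_cat; apply/orP; left; apply/flatten_mapP; exists r.
  move=> /(extend_appears S r y g swap_inj xA)[s sr]; apply: xyF.
  by rewrite mem_cat; apply/orP; right; apply/flatten_mapP; exists r.
- move=> [[xA xF] [yB yF]]; split=> [g|s g]; first by rewrite alphabetE xA yB.
  rewrite mem_cat => /orP[] /flatten_mapP[r rF sr] sxy.
    by apply: (xF r g rF); apply/(extend_appears S r x g to_inj yB); exists s.
  by apply: (yF r g rF); apply/(extend_appears S r y g swap_inj xA); exists s.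
Qed.

Lemma product_empty p q :
  subshift_of S p = set0 -> subshift_of S (product p q) = set0.
Proof.
move=> p0; apply/eqP/negP => /negP/set0P[z].
by rewrite -(combine_coordinates z) subshift_of_product p0 => -[].
Qed.

(** Each coordinate of the image depends on one coordinate of the argument. *)
Lemma letterwise_continuous (f : nat -> nat) :
  continuous (fun z : config G => (fun g => f (z g)) : config G).
Proof.
move=> z; apply/cvg_sup => g U [V [[W oW <-] Wz WU]].
apply: filterS WU _; rewrite nbhs_simpl /=.
have near_zg : nbhs z [set y : config G | y g = z g]%classic.
  by apply: (@proj_continuous G (fun=> nat) g z [set z g]%classic);
    apply: discrete_set1.
by apply: filterS near_zg => y /= ->.
Qed.

(** Any one point of the first factor lifts all points of the second. *)
Lemma product_factor p q : subshift_of S p <> set0 ->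
  is_factor (subshift_of S q) (subshift_of S (product p q)).
Proof.
move=> /eqP/set0P[x px]; exists second_coordinate.
- split=> //.
  + by move=> z; rewrite -{1}(combine_coordinates z) => /subshift_of_product[].
  + apply: continuous_subspaceT.
    exact: (@letterwise_continuous (fun k => (Cantor.of_nat k).2)).
- move=> y qy; exists (combine x y); last exact: second_combine.
  exact/subshift_of_product.
Qed.

End Product.

(** * Reductions from the domino problem *)

Lemma recursive_eq0 f : recursive f -> recursive (fun m => f m == 0 : nat).
Proof.
move=> rf; pose is0 := recursive_case (recursive_const 1) (recursive_const 0).
have := rec_comp is0 (rec_pair rec_zero rf).
congr recursive; apply/funext => m.
by rewrite Cantor.cancel_of_to; case: (f m).
Qed.

Theorem corollary3p7 (G : groupType) (n : nat) (S : n.-tuple G)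
    (hS : symmetric_generating S)
    (hDP : ~ decidable_set (@code_presentation n) (domino_problem S))
    (P : set (set (config G)))
    (hP : dynamical_property S P) (hnt : nontrivial_property S P) :
  (preserved_to_factors S P -> P set0 -> property_undecidable S P) /\
  (preserved_to_extensions S P -> ~ P set0 -> property_undecidable S P).
Proof.
have sft p : is_SFT S (subshift_of S p) by exists p.
case: hnt => [[_ [q_yes ->] Pq] [_ [q_no ->] nPq]].
split=> [factP P0|extP nP0] [f rf fP]; apply: hDP.
- have [F rF FE] := computable_product q_no.
  exists (fun m => f (F m)); first exact: rec_comp.
  move=> p; rewrite FE fP; congr nat_of_bool; apply/asbool_equiv_eq.
  split=> [Ppq|p0]; last by rewrite /= product_empty.
  apply: contra_notP nPq => p0.
  exact: factP _ _ (sft _) (sft _) (product_factor _ p0) Ppq.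
- have [F rF FE] := computable_product q_yes.
  (* The reduction exchanges yes and no: a nonempty product has the property. *)
  exists (fun m => f (F m) == 0 : nat).
    by apply: recursive_eq0; apply: rec_comp.
  move=> p; rewrite FE fP eqb0 -asbool_neg; congr nat_of_bool.
  apply/asbool_equiv_eq; split=> [nPpq|p0]; last by rewrite /= product_empty.
  apply: contra_notP nPpq => p0.
  exact: extP _ _ (sft _) (sft _) (product_factor _ p0) Pq.
Qed.
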